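(* Let $(\mathfrak g,[\cdot,\cdot,\cdot]_{\mathfrak g})$ be a finite-dimensional $3$-Lie algebra over $\mathbb R$ or $\mathbb C$. Then $\mathfrak g$ has a product structure if and only if $\mathfrak g$ admits a decomposition $\mathfrak g=\mathfrak g_+\oplus\mathfrak g_-$ (direct sum of vector spaces), where $\mathfrak g_+$ and $\mathfrak g_-$ are nonzero subalgebras of $\mathfrak g$.
   Context: A $3$-Lie algebra is a vector space $\mathfrak g$ with a trilinear skew-symmetric bracket $[\cdot,\cdot,\cdot]_{\mathfrak g}$ satisfying $[x,y,[z,w,v]]=[[x,y,z],w,v]+[z,[x,y,w],v]+[z,w,[x,y,v]]$. An almost product structure on $\mathfrak g$ is a linear map $E:\mathfrak g\to\mathfrak g$ with $E^2=\mathrm{Id}$ and $E\neq\pm\mathrm{Id}$. It is a product structure if for all $x,y,z\in\mathfrak g$ $$E[x,y,z]_{\mathfrak g}=[Ex,Ey,Ez]_{\mathfrak g}+[Ex,y,z]_{\mathfrak g}+[x,Ey,z]_{\mathfrak g}+[x,y,Ez]_{\mathfrak g}-E[Ex,Ey,z]_{\mathfrak g}-E[x,Ey,Ez]_{\mathfrak g}-E[Ex,y,Ez]_{\mathfrak g}.$$ *)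

(* Defs.v *)
From HB Require Import structures.
From mathcomp Require Import all_boot all_order all_algebra.
From mathcomp Require Import reals.
From mathcomp Require Import complex.

Set Implicit Arguments.
Unset Strict Implicit.
Unset Printing Implicit Defensive.

Import GRing.Theory.

Local Open Scope ring_scope.

(* A realType is a model of the reals, unique up to isomorphism, and R[i] is
   its complexification. *)
Variant real_or_complex (R : realType) : fieldType -> Prop :=
  | ground_real : real_or_complex R (R : fieldType)
  | ground_complex : real_or_complex R (R[i] : fieldType).

(* The two adjacent transpositions generate S_3, hence skew-symmetry in all
   three arguments; over the fields considered here (characteristic 0) this
   is the same as being alternating. *)
Record lie3_bracket (K : fieldType) (g : vectType K) := Lie3Bracket {
  br3 :> g -> g -> g -> g;
  br3_linear1 : forall y z, linear (fun x => br3 x y z);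
  br3_linear2 : forall x z, linear (fun y => br3 x y z);
  br3_linear3 : forall x y, linear (fun z => br3 x y z);
  br3_skew12 : forall x y z, br3 y x z = - br3 x y z;
  br3_skew23 : forall x y z, br3 x z y = - br3 x y z;
  br3_fundamental : forall x y z w v,
    br3 x y (br3 z w v) =
      br3 (br3 x y z) w v + br3 z (br3 x y w) v + br3 z w (br3 x y v) }.

Section Structures.
Variables (K : fieldType) (g : vectType K) (br : lie3_bracket g).

Definition almost_product_structure (E : 'End(g)) : Prop :=
  [/\ (E \o E)%VF = \1%VF, E <> \1%VF & E <> - \1%VF].

Definition product_structure (E : 'End(g)) : Prop :=
  almost_product_structure E /\
  forall x y z : g,
    E (br x y z) =
      br (E x) (E y) (E z) + br (E x) y z + br x (E y) z + br x y (E z)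
      - E (br (E x) (E y) z) - E (br x (E y) (E z)) - E (br (E x) y (E z)).

Definition subalgebra (h : {vspace g}) : Prop :=
  forall x y z, x \in h -> y \in h -> z \in h -> br x y z \in h.

End Structures.

(* Main.v *)
Require Import Defs.
From mathcomp Require Import all_boot all_order all_algebra.
From mathcomp Require Import reals.
From mathcomp Require Import complex.
From mathcomp Require Import ring.

(** The subspaces [gp] and [gm] are the eigenspaces of [E] for the eigenvalues
1 and -1.  An involution is diagonalizable when 2 is invertible, so giving [E]
amounts to giving the decomposition, and only the integrability condition has
to be understood.  That condition is trilinear in [(x, y, z)], hence it may be
tested on eigenvectors.  If [E] acts on [x], [y], [z] by signs [s], [t], [u]
and [b := br x y z], it reads
   (1 + s t + t u + s u) E b = (s t u + s + t + u) b,
and since [s * s = 1] the right-hand coefficient is [s] times the left-hand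
one, so that the condition becomes
   (1 + s t + t u + s u) (E b - s b) = 0      ([product_defect_eigen]).
The scalar factor is 4 when the three signs agree and 0 otherwise.  Thus
mixed triples impose nothing, and the triples of one sign say exactly that the
eigenspace of that sign is a subalgebra. *)

Import GRing.Theory Num.Theory.

Local Open Scope ring_scope.

Local Set Implicit Arguments.
Local Unset Strict Implicit.

Lemma two_neq0_real_or_complex (R : realType) (K : fieldType) :
  real_or_complex R K -> 2%:R != 0 :> K.
Proof. by case; rewrite pnatr_eq0. Qed.

Section Additivity.
Variables (K : fieldType) (U V : lmodType K) (f : U -> V).
Hypothesis f_linear : linear f.

Lemma linear_fun_add x y : f (x + y) = f x + f y.
Proof. by have := f_linear 1 x y; rewrite !scale1r. Qed.

Lemma linear_fun_scale a x : f (a *: x) = a *: f x.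
Proof.
have f0 : f 0 = 0.
  by apply: (addrI (f 0)); rewrite -linear_fun_add !addr0.
by have := f_linear a x 0; rewrite f0 !addr0.
Qed.

End Additivity.

(** * Eigenspaces of an endomorphism *)

Section Eigenspaces.
Variables (K : fieldType) (g : vectType K).
Implicit Types (E : 'End(g)) (s : K) (x : g).

Lemma mem_leigenspace E s x : (x \in passmx.leigenspace E s) = (E x == s *: x).
Proof.
by rewrite memv_ker add_lfunE opp_lfunE scale_lfunE id_lfunE subr_eq0.
Qed.

(** The eigencomponents of [x] are the averages (x + E x) / 2 and (x - E x) / 2. *)
Lemma involution_eigen_split E : 2%:R != 0 :> K -> (E \o E)%VF = \1%VF ->
  forall x, exists xp xm, [/\ E xp = xp, E xm = - xm & x = xp + xm].
Proof.
move=> two_neq0 EE x.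
have EEx : E (E x) = x by rewrite -comp_lfunE EE id_lfunE.
exists (2%:R^-1 *: (x + E x)), (2%:R^-1 *: (x - E x)); split.
- by rewrite linearZ linearD /= EEx addrC.
- by rewrite linearZ linearB /= EEx -scalerN opprB.
rewrite -scalerDr addrACA subrr addr0 -mulr2n -scaler_nat scalerA.
by rewrite mulVf ?scale1r.
Qed.

(** The difference of the two projections attached to the decomposition. *)
Lemma exists_reflection (gp gm : {vspace g}) :
  directv (gp + gm) ->
  exists E : 'End(g), (forall x, x \in gp -> E x = x) /\
                      (forall x, x \in gm -> E x = - x).
Proof.
move=> /directv_addP gpm0.
have gmp0 : (gm :&: gp = 0)%VS by rewrite capvC.
have pi_other (U V : {vspace g}) x :
    (U :&: V = 0)%VS -> x \in U -> daddv_pi V U x = 0.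
  move=> UV0 xU; have xUV : x \in (U + V)%VS.
    by rewrite (subvP (addvSl U V)).
  apply: (addrI x); rewrite addr0.
  by have := daddv_pi_add UV0 xUV; rewrite (daddv_pi_id UV0 xU).
exists (daddv_pi gp gm - daddv_pi gm gp); split=> x xin.
  by rewrite add_lfunE opp_lfunE daddv_pi_id // pi_other // subr0.
by rewrite add_lfunE opp_lfunE pi_other // daddv_pi_id // sub0r.
Qed.

End Eigenspaces.

(** * The integrability defect *)

Section Defect.
Variables (K : fieldType) (g : vectType K) (br : lie3_bracket g).
Variable E : 'End(g).

(** Gathering both sides of the product structure identity makes it the vanishing
of a trilinear map, which can be tested on eigenvectors. *)
Definition product_defect (x y z : g) : g :=
  E (br x y z) -
  (br (E x) (E y) (E z) + br (E x) y z + br x (E y) z + br x y (E z)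
   - E (br (E x) (E y) z) - E (br x (E y) (E z)) - E (br (E x) y (E z))).

(** The additivity of the eight-term sum with the signs of [product_defect],
separated from the bracket because it serves all three arguments. *)
Lemma signed_sum_add (V : zmodType)
    (a b c d e h k l a' b' c' d' e' h' k' l' : V) :
  (a + a') - ((b + b') + (c + c') + (d + d') + (e + e')
              - (h + h') - (k + k') - (l + l')) =
  (a - (b + c + d + e - h - k - l)) + (a' - (b' + c' + d' + e' - h' - k' - l')).
Proof.
rewrite [RHS]addrACA; congr (_ + _); rewrite -opprD; congr (- _).
rewrite (opprD h) (opprD k) (opprD l).
by do 6![rewrite [RHS]addrACA; congr (_ + _)].
Qed.

Let br_add1 x x' y z : br (x + x') y z = br x y z + br x' y z.
Proof. exact: (linear_fun_add (br3_linear1 br y z)). Qed.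

Let br_add2 x y y' z : br x (y + y') z = br x y z + br x y' z.
Proof. exact: (linear_fun_add (br3_linear2 br x z)). Qed.

Let br_add3 x y z z' : br x y (z + z') = br x y z + br x y z'.
Proof. exact: (linear_fun_add (br3_linear3 br x y)). Qed.

Let br_scale1 a x y z : br (a *: x) y z = a *: br x y z.
Proof. exact: (linear_fun_scale (br3_linear1 br y z)). Qed.

Let br_scale2 a x y z : br x (a *: y) z = a *: br x y z.
Proof. exact: (linear_fun_scale (br3_linear2 br x z)). Qed.

Let br_scale3 a x y z : br x y (a *: z) = a *: br x y z.
Proof. exact: (linear_fun_scale (br3_linear3 br x y)). Qed.

Lemma product_defect_add1 x x' y z :
  product_defect (x + x') y z = product_defect x y z + product_defect x' y z.
Proof.
rewrite /product_defect !(linearD E) !br_add1 !(linearD E).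
exact: signed_sum_add.
Qed.

Lemma product_defect_add2 x y y' z :
  product_defect x (y + y') z = product_defect x y z + product_defect x y' z.
Proof.
rewrite /product_defect !(linearD E) !br_add2 !(linearD E).
exact: signed_sum_add.
Qed.

Lemma product_defect_add3 x y z z' :
  product_defect x y (z + z') = product_defect x y z + product_defect x y z'.
Proof.
rewrite /product_defect !(linearD E) !br_add3 !(linearD E).
exact: signed_sum_add.
Qed.

(** Comparing coefficients of [E (br x y z)] and [br x y z]: the bracket collects
s t u + s + t + u, out of which [s] can be pulled because [s * s = 1]. *)
Lemma product_defect_eigen s t u x y z :
  s * s = 1 -> E x = s *: x -> E y = t *: y -> E z = u *: z ->
  product_defect x y z =
    (1 + s * t + t * u + s * u) *: (E (br x y z) - s *: br x y z).
Proof.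
move=> ss Ex Ey Ez; rewrite /product_defect Ex Ey Ez.
rewrite !(br_scale1, br_scale2, br_scale3) !(linearZZ E) /=.
set b := br x y z; set c := E b.
rewrite !scalerA scalerBr scalerA.
have -> : (1 + s * t + t * u + s * u) * s = s * t * u + s + t + u.
  transitivity (s + s * s * t + s * t * u + s * s * u); first by ring.
  by rewrite ss; ring.
rewrite -!scalerDl -!addrA -!opprD !opprB -!scalerDl.
by rewrite [in RHS]scalerDl scale1r -addrA.
Qed.

Hypothesis two_neq0 : 2%:R != 0 :> K.

(** The scalar factor of [product_defect_eigen] is then 4, which is invertible
because 2 is. *)
Lemma product_defect_same_sign s x y z :
  s * s = 1 -> E x = s *: x -> E y = s *: y -> E z = s *: z ->
  product_defect x y z = 0 <-> E (br x y z) = s *: br x y z.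
Proof.
move=> ss Ex Ey Ez; rewrite (product_defect_eigen ss Ex Ey Ez) ss.
have -> : 1 + 1 + 1 + 1 = 2%:R * 2%:R :> K by ring.
split=> [/eqP|->]; last by rewrite subrr scaler0.
by rewrite scaler_eq0 mulf_eq0 (negPf two_neq0) /= subr_eq0 => /eqP.
Qed.

End Defect.

(** * Product structures and decompositions *)

Section Correspondence.
Variables (K : fieldType) (g : vectType K) (br : lie3_bracket g).
Hypothesis two_neq0 : 2%:R != 0 :> K.

Lemma product_structureP (E : 'End(g)) :
  product_structure br E <->
  almost_product_structure E /\ forall x y z, product_defect br E x y z = 0.
Proof.
split=> -[EE Edef]; split=> // x y z.
  by rewrite /product_defect -Edef subrr.
exact/subr0_eq/Edef.
Qed.

Lemma subalgebra_leigenspace (E : 'End(g)) s :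
  s * s = 1 -> (forall x y z, product_defect br E x y z = 0) ->
  subalgebra br (passmx.leigenspace E s).
Proof.
move=> ss Edef x y z; rewrite !mem_leigenspace => /eqP Ex /eqP Ey /eqP Ez.
exact/eqP/(product_defect_same_sign br two_neq0 ss Ex Ey Ez)/Edef.
Qed.

Lemma oppr_eq_self0 (x : g) : - x = x -> x = 0.
Proof.
move=> /eqP; rewrite eq_sym -addr_eq0 -mulr2n -scaler_nat scaler_eq0.
by rewrite (negPf two_neq0) => /eqP.
Qed.

Lemma decomposition_of_product_structure (E : 'End(g)) :
  product_structure br E ->
  exists gp gm : {vspace g},
     [/\ (gp + gm)%VS = fullv, directv (gp + gm),
         gp <> 0%VS, gm <> 0%VS &
         subalgebra br gp /\ subalgebra br gm].
Proof.
move=> /product_structureP[[EE E1 EN1] Edef].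
have split_x := involution_eigen_split two_neq0 EE.
have gpP x : (x \in passmx.leigenspace E 1) = (E x == x).
  by rewrite mem_leigenspace scale1r.
have gmP x : (x \in passmx.leigenspace E (-1)) = (E x == - x).
  by rewrite mem_leigenspace scaleN1r.
exists (passmx.leigenspace E 1), (passmx.leigenspace E (-1)); split.
- apply/eqP; rewrite eqEsubv subvf; apply/subvP=> x _.
  have [xp [xm [Exp Exm ->]]] := split_x x.
  by rewrite memv_add ?gpP ?gmP ?Exp ?Exm.
- apply/directv_addP/eqP; rewrite -subv0; apply/subvP=> x.
  rewrite memv_cap memv0 gpP gmP => /andP[/eqP-> /eqP xN].
  by apply/eqP/oppr_eq_self0.
- move=> gp0; apply: EN1; apply/lfunP=> x; rewrite opp_lfunE id_lfunE.
  have [xp [xm [Exp Exm ->]]] := split_x x.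
  have : xp \in passmx.leigenspace E 1 by rewrite gpP Exp.
  by rewrite gp0 memv0 => /eqP->; rewrite add0r.
- move=> gm0; apply: E1; apply/lfunP=> x; rewrite id_lfunE.
  have [xp [xm [Exp Exm ->]]] := split_x x.
  have : xm \in passmx.leigenspace E (-1) by rewrite gmP Exm.
  by rewrite gm0 memv0 => /eqP->; rewrite addr0.
by split; apply: subalgebra_leigenspace; rewrite ?mulr1 ?mulrNN ?mulr1.
Qed.

Lemma product_structure_of_decomposition (gp gm : {vspace g}) :
  (gp + gm)%VS = fullv -> directv (gp + gm) -> gp <> 0%VS -> gm <> 0%VS ->
  subalgebra br gp -> subalgebra br gm ->
  exists E : 'End(g), product_structure br E.
Proof.
move=> gpm_full gpm_direct gp_neq0 gm_neq0 gp_sub gm_sub.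
have [E [Ep Em]] := exists_reflection gpm_direct.
have split_x x : exists2 xp, xp \in gp & exists2 xm, xm \in gm & x = xp + xm.
  by apply/memv_addP; rewrite gpm_full memvf.
exists E; apply/product_structureP; split.
  split.
  - apply/lfunP=> x; rewrite comp_lfunE id_lfunE.
    have [xp xp_in [xm xm_in ->]] := split_x x.
    rewrite linearD /= (Ep xp) // (Em xm) //.
    by rewrite linearB /= (Ep xp) // (Em xm) // opprK.
  - move=> E1; apply: gm_neq0; apply/eqP; rewrite -subv0; apply/subvP=> x xin.
    by rewrite memv0; apply/eqP/oppr_eq_self0; rewrite -Em // E1 id_lfunE.
  - move=> EN1; apply: gp_neq0; apply/eqP; rewrite -subv0; apply/subvP=> x xin.
    rewrite memv0; apply/eqP/oppr_eq_self0.
    by rewrite -[RHS](Ep _ xin) EN1 opp_lfunE id_lfunE.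
have Ep1 x : x \in gp -> E x = 1 *: x by rewrite scale1r; apply: Ep.
have Em1 x : x \in gm -> E x = -1 *: x by rewrite scaleN1r; apply: Em.
move=> x y z.
have [xp xp_in [xm xm_in ->]] := split_x x.
have [yp yp_in [ym ym_in ->]] := split_x y.
have [zp zp_in [zm zm_in ->]] := split_x z.
have ss : 1 * 1 = 1 :> K by rewrite mulr1.
have ssN : (-1) * (-1) = 1 :> K by rewrite mulrNN mulr1.
have ppp : product_defect br E xp yp zp = 0.
  apply/(product_defect_same_sign br two_neq0 ss); try exact: Ep1.
  by apply/Ep1/gp_sub.
have mmm : product_defect br E xm ym zm = 0.
  apply/(product_defect_same_sign br two_neq0 ssN); try exact: Em1.
  by apply/Em1/gm_sub.
(* Of the eight sign patterns, the two constant ones vanish because [gp] and [gm]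
   are subalgebras, the six others because their scalar factor is 0. *)
rewrite product_defect_add1 !product_defect_add2 !product_defect_add3 ppp mmm.
have mixed a b c s t u : s * s = 1 -> 1 + s * t + t * u + s * u = 0 ->
    E a = s *: a -> E b = t *: b -> E c = u *: c ->
    product_defect br E a b c = 0.
  move=> s2 stu Ea Eb Ec.
  by rewrite (product_defect_eigen br s2 Ea Eb Ec) stu scale0r.
rewrite (mixed xp yp zm 1 1 (-1)) ?(mixed xp ym zp 1 (-1) 1)
  ?(mixed xp ym zm 1 (-1) (-1)) ?(mixed xm yp zp (-1) 1 1)
  ?(mixed xm yp zm (-1) 1 (-1)) ?(mixed xm ym zp (-1) (-1) 1)
  ?addr0 //; try exact: Ep1; try exact: Em1; ring.
Qed.

End Correspondence.

Local Unset Implicit Arguments.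

Theorem theorem5p3 (R : realType) (K : fieldType) (hK : real_or_complex R K)
    (g : vectType K) (br : lie3_bracket g) :
  (exists E : 'End(g), product_structure br E) <->
  (exists gp gm : {vspace g},
     [/\ (gp + gm)%VS = fullv, directv (gp + gm),
         gp <> 0%VS, gm <> 0%VS &
         subalgebra br gp /\ subalgebra br gm]).
Proof.
have two_neq0 := two_neq0_real_or_complex hK.
split=> [[E] | [gp [gm [full direct gp0 gm0 [gp_sub gm_sub]]]]].
  exact: decomposition_of_product_structure.
exact: (product_structure_of_decomposition two_neq0 full direct).
Qed.
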